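(* Let $H$ be a graph and let $\widehat H$ be the graph obtained from $H$ by adding a new vertex adjacent to all vertices of $H$. Suppose that for every $\eta>0$ there exist $\rho>0$ and $n_0$ such that $t_H(G)\ge d^{|E(H)|}-\eta$ for every $d$ and every $(\rho,d)$-dense graph $G$ with $|V(G)|\ge n_0$. Then the same holds for $\widehat H$: for every $\eta>0$ there exist $\rho'>0$ and $n_0'$ such that $t_{\widehat H}(G)\ge d^{|E(\widehat H)|}-\eta$ for every $d$ and every $(\rho',d)$-dense graph $G$ with $|V(G)|\ge n_0'$.
   Context: All graphs are finite and simple. For graphs $H,G$, $\mathrm{Hom}(H,G)$ is the set of graph homomorphisms from $H$ to $G$, and $t_H(G)=|\mathrm{Hom}(H,G)|/|V(G)|^{|V(H)|}$. A graph $G$ is $(\rho,d)$-dense if every $X\subseteq V(G)$ with $|X|\ge\rho|V(G)|$ spans at least $\frac d2|X|^2$ edges.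
   Formalization: In both the hypothesis and the conclusion, ''every d'' is read as every real d ≥ 0; for negative d every graph is (ρ,d)-dense and the literal claim fails, e.g. for H an edge plus an isolated vertex. *)

(* Defs.v *)
From mathcomp Require Import all_boot all_order all_algebra.
From mathcomp Require Import reals.

Set Implicit Arguments.
Unset Strict Implicit.
Unset Printing Implicit Defensive.

Import Order.TTheory GRing.Theory Num.Theory.

Local Open Scope ring_scope.

Record sgraph := SGraph {
  vertex :> finType;
  adj : rel vertex;
  adj_sym : symmetric adj;
  adj_irrefl : irreflexive adj }.

Definition edges (G : sgraph) : {set {set G}} :=
  [set [set p.1; p.2] | p : G * G & adj p.1 p.2].

Definition edges_in (G : sgraph) (X : {set G}) : {set {set G}} :=
  [set e in edges G | e \subset X].

Definition is_hom (H G : sgraph) (f : {ffun H -> G}) : bool :=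
  [forall x, forall y, adj x y ==> adj (f x) (f y)].

Definition Hom (H G : sgraph) : {set {ffun H -> G}} := [set f | is_hom f].

(* When G has no vertices the denominator may be 0, and the quotient is then 0
   by the convention 0^-1 = 0. *)
Definition hom_density (R : realType) (H G : sgraph) : R :=
  #|Hom H G|%:R / #|G|%:R ^+ #|H|.

Definition locally_dense (R : realType) (rho d : R) (G : sgraph) : Prop :=
  forall X : {set G}, rho * #|G|%:R <= #|X|%:R ->
    d / 2 * #|X|%:R ^+ 2 <= #|edges_in X|%:R.

Section Cone.
Variable H : sgraph.

(* None is the new vertex. *)
Definition cone_adj (x y : option H) : bool :=
  match x, y with
  | Some u, Some v => adj u v
  | None, None => false
  | _, _ => true
  end.

Lemma cone_adj_sym : symmetric cone_adj.
Proof. by move=> [u|] [v|] //=; rewrite adj_sym. Qed.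

Lemma cone_adj_irrefl : irreflexive cone_adj.
Proof. by move=> [u|] //=; rewrite adj_irrefl. Qed.

Definition cone : sgraph := SGraph cone_adj_sym cone_adj_irrefl.
End Cone.

(* The densities d are nonnegative. For negative d every graph is
   (rho, d)-dense, while d ^+ #|edges H| can be arbitrarily large. *)
Definition KNRS (R : realType) (H : sgraph) : Prop :=
  forall eta : R, 0 < eta ->
    exists2 rho : R, 0 < rho &
      exists n0 : nat, forall (d : R) (G : sgraph), 0 <= d ->
        locally_dense rho d G -> (n0 <= #|G|)%N ->
        d ^+ #|edges H| - eta <= hom_density R H G.

(* Main.v *)
Require Import Defs.
From mathcomp Require Import all_boot all_order all_algebra.
From mathcomp Require Import reals.
From mathcomp Require Import ring lra.

(* Homomorphisms of the cone sending the apex to [v] are the homomorphisms from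
   [H] to the graph induced on the neighbourhood [N(v)]. A neighbourhood of size
   at least [delta n] inherits local density with [rho] in place of
   [delta rho], so it carries at least [(d ^ e(H) - eta) deg(v) ^ |H|] of them;
   smaller neighbourhoods are negligible. Convexity of [x ^ |H|] and an average
   degree of at least [d n] then give [sum_v deg(v) ^ |H| >= n (d n) ^ |H|]. *)

Set Implicit Arguments.
Unset Strict Implicit.
Unset Printing Implicit Defensive.

(* [all_algebra] shadows [Hom]. *)
Import Defs.
Import Order.TTheory GRing.Theory Num.Theory.

Local Open Scope ring_scope.

Section PowerMean.
Variable R : realFieldType.

(** The tangent line at [a] of a convex power. After multiplying the induction hypothesis by [x],
    the slack left over is [k.+1 * a ^+ k * (x - a) ^+ 2]. *)
Lemma expr_tangent (a x : R) (k : nat) : 0 <= a -> 0 <= x ->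
  a ^+ k.+1 + k.+1%:R * a ^+ k * (x - a) <= x ^+ k.+1.
Proof.
move=> a0 x0; elim: k => [|k IHk]; first by rewrite !expr1 expr0; lra.
rewrite [leRHS]exprSr; apply: le_trans (ler_wpM2r x0 IHk).
rewrite -subr_ge0 -[k.+2%:R]natr1 !exprS.
set m : R := k.+1%:R; set b := a ^+ k.
have -> : (a * b + m * b * (x - a)) * x -
    (a * (a * b) + (m + 1) * (a * b) * (x - a)) = m * b * (x - a) ^+ 2.
  by ring.
by rewrite mulr_ge0 ?sqr_ge0 // mulr_ge0 ?ler0n ?exprn_ge0.
Qed.

(** Summing the tangents at [a] leaves a linear term that is a nonnegative multiple of
    [\sum_v F v - #|T| * a]. Thus [a] may be any lower bound on the mean. *)
Lemma sum_expr_ge (T : finType) (F : T -> R) (a : R) (k : nat) :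
  0 <= a -> (forall v, 0 <= F v) -> #|T|%:R * a <= \sum_v F v ->
  #|T|%:R * a ^+ k <= \sum_v F v ^+ k.
Proof.
move=> a0 F0 avg; case: k => [|k].
  by rewrite expr0 mulr1 (eq_bigr (fun=> 1)) // sumr_const.
apply: le_trans (ler_sum _ (fun v _ => expr_tangent k a0 (F0 v))).
rewrite big_split /= sumr_const -mulr_sumr sumrB sumr_const.
rewrite -(mulr_natl (a ^+ _)) -(mulr_natl a).
by rewrite lerDl mulr_ge0 ?subr_ge0 // mulr_ge0 ?ler0n ?exprn_ge0.
Qed.

End PowerMean.

Definition nbhd (G : sgraph) (v : G) : {set G} := [set x | adj v x].

(** Degrees count ordered adjacent pairs, and each edge comes from at least two of them, its
    orientations, which differ by irreflexivity. *)
Lemma card_edges_sum_deg (G : sgraph) :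
  (2 * #|edges G| <= \sum_(v : G) #|nbhd v|)%N.
Proof.
pose f (p : G * G) : {set G} := [set p.1; p.2].
pose P := [set p : G * G | adj p.1 p.2].
have edgesE : edges G = f @: P.
  by apply/setP => e; apply/imsetP/imsetP => -[p]; rewrite inE => hp ->;
    exists p; rewrite ?inE.
have -> : (\sum_(v : G) #|nbhd v| = #|P|)%N.
  rewrite -sum1_card (eq_bigr (fun v => \sum_(w | adj v w) 1)%N); last first.
    by move=> v _; rewrite -sum1_card; apply: eq_bigl => w; rewrite inE.
  rewrite pair_big_dep; apply: eq_bigl => p; by rewrite inE.
rewrite edgesE -(sum1_card (mem P)) (partition_big_imset f) /= mulnC -sum_nat_const.
apply: leq_sum => e /imsetP [[x y]]; rewrite inE /= => xy ->.
have xNy : x != y by apply: contraL xy => /eqP ->; rewrite adj_irrefl.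
rewrite sum1_card.
have <- : #|[set (x, y); (y, x)]| = 2%N by rewrite cards2 xpair_eqE negb_and xNy.
apply/subset_leq_card/subsetP => p; rewrite !inE.
by case/orP => /eqP ->; rewrite unfold_in /= inE /= ?[adj y x]adj_sym xy //= /f /= setUC.
Qed.

Section Induced.
Variables (G : sgraph) (A : {set G}).

Definition induced_adj : rel {x : G | x \in A} := fun x y => adj (val x) (val y).

Lemma induced_adj_sym : symmetric induced_adj.
Proof. by move=> x y; rewrite /induced_adj adj_sym. Qed.

Lemma induced_adj_irrefl : irreflexive induced_adj.
Proof. by move=> x; rewrite /induced_adj adj_irrefl. Qed.

Definition induced : sgraph := SGraph induced_adj_sym induced_adj_irrefl.

Lemma card_induced : #|induced| = #|A|.
Proof. exact: card_sig. Qed.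

Definition liftset (X : {set induced}) : {set G} :=
  [set sval (x : {x : G | x \in A}) | x in X].

(** Every edge inside [liftset X] is the image under [liftset] of an edge inside [X]. *)
Lemma card_edges_in_induced (X : {set induced}) :
  (#|edges_in (liftset X)| <= #|edges_in X|)%N.
Proof.
apply: leq_trans (leq_imset_card liftset _).
apply/subset_leq_card/subsetP => e; rewrite inE => /andP [/imsetP [[x y]]].
rewrite inE /= => xy -> sub.
have /imsetP [x' x'X xE] : x \in liftset X by apply: (subsetP sub); rewrite !inE eqxx.
have /imsetP [y' y'X yE] : y \in liftset X.
  by apply: (subsetP sub); rewrite !inE eqxx orbT.
apply/imsetP; exists [set x'; y'].
  rewrite inE; apply/andP; split.
    by apply/imsetP; exists (x', y') => //; rewrite inE /= /induced_adj /= -xE -yE.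
  by apply/subsetP => z; rewrite !inE => /orP [] /eqP ->.
by rewrite /liftset imsetU1 imset_set1 xE yE.
Qed.

Lemma locally_dense_induced (R : realType) (rho delta d : R) :
  0 <= rho -> delta * #|G|%:R <= #|A|%:R ->
  locally_dense (delta * rho) d G -> locally_dense rho d induced.
Proof.
move=> rho0 Abig dense X; rewrite card_induced => Xbig.
have cX : #|liftset X| = #|X| by apply: card_imset; exact: val_inj.
have := dense (liftset X); rewrite cX => /(_ _) H.
apply: le_trans (H _) _; last by rewrite ler_nat card_edges_in_induced.
by apply: le_trans Xbig; rewrite -mulrA mulrCA ler_wpM2l.
Qed.

End Induced.

Lemma locally_dense_le (R : realType) (rho rho' d : R) (G : sgraph) :
  rho' <= rho -> locally_dense rho' d G -> locally_dense rho d G.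
Proof.
by move=> le dense X hX; apply: dense; apply: le_trans hX; rewrite ler_wpM2r.
Qed.

(** Since [rho <= 1], local density applies to the whole vertex set. *)
Lemma sum_deg_ge (R : realType) (rho d : R) (G : sgraph) :
  rho <= 1 -> locally_dense rho d G ->
  #|G|%:R * (d * #|G|%:R) <= \sum_(v : G) #|nbhd v|%:R.
Proof.
move=> rho1 /(_ setT); rewrite cardsT ler_piMl ?ler0n // => /(_ isT).
have -> : edges_in [set: G] = edges G by apply/setP => e; rewrite inE subsetT andbT.
have := card_edges_sum_deg G; rewrite -(ler_nat R) natrM natr_sum; nra.
Qed.

(** The average degree is at least [d * #|G|] and at most [#|G|]. This bound makes powers of [d]
    decrease with the exponent. *)
Lemma locally_dense_le1 (R : realType) (rho d : R) (G : sgraph) :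
  rho <= 1 -> (0 < #|G|)%N -> locally_dense rho d G -> d <= 1.
Proof.
move=> rho1 G0 /(sum_deg_ge rho1) le; have n0 : 0 < #|G|%:R :> R by rewrite ltr0n.
have : \sum_(v : G) #|nbhd v|%:R <= \sum_(v : G) #|G|%:R :> R.
  by apply: ler_sum => v _; rewrite ler_nat max_card.
rewrite sumr_const -(mulr_natl #|G|%:R) => /(le_trans le).
by rewrite ler_pM2l // ger_pMl.
Qed.

Section Cone.
Variable H : sgraph.

Lemma card_edges_cone : (#|edges H| + #|H| <= #|edges (cone H)|)%N.
Proof.
pose base (e : {set H}) : {set cone H} := [set Some x | x in e].
pose spoke (x : H) : {set cone H} := [set None; Some x].
have base_inj : injective base by apply: imset_inj => x y [].
have spoke_inj : injective spoke.
  by move=> x y /setP /(_ (Some x)); rewrite !inE eqxx /= => /esym /eqP [].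
rewrite -(card_imset _ base_inj) -cardsT -(card_imset _ spoke_inj).
have disj : [disjoint base @: edges H & spoke @: setT].
  apply/pred0Pn => -[e /andP [/imsetP [e' _ ->] /imsetP [x _ /setP /(_ None)]]].
  by rewrite !inE eqxx => /imsetP [].
move: disj; rewrite -(leq_card_setU _ _).2 => /eqP <-.
apply/subset_leq_card/subsetP => e; rewrite inE.
case/orP => /imsetP.
  case=> _ /imsetP [[x y] xy ->] ->; apply/imsetP.
  exists (Some x, Some y); first by move: xy; rewrite !inE.
  by rewrite /base imsetU1 imset_set1.
by case=> x _ ->; apply/imsetP; exists (None, Some x); rewrite ?inE.
Qed.

(** Split the homomorphisms by the image [v] of the apex; [ext] embeds those into the neighbourhood
    of [v] in the class of [v]. *)
Lemma card_Hom_cone (G : sgraph) :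
  (\sum_(v : G) #|Hom H (induced (nbhd v))| <= #|Hom (cone H) G|)%N.
Proof.
rewrite -(sum1_card (mem (Hom (cone H) G))).
rewrite (partition_big (fun f : {ffun cone H -> G} => f None) predT) //=.
apply: leq_sum => v _; rewrite sum1_card.
pose ext (g : {ffun H -> induced (nbhd v)}) : {ffun cone H -> G} :=
  [ffun o => if o is Some x then sval (g x : {x : G | x \in nbhd v}) else v].
have ext_inj : injective ext.
  move=> g g' /ffunP E; apply/ffunP => x; have := E (Some x).
  by rewrite !ffunE => /val_inj.
rewrite -(card_imset _ ext_inj).
apply/subset_leq_card/subsetP => _ /imsetP [g gH ->].
move: gH; rewrite inE => gH; rewrite unfold_in /= inE [X in X == v]ffunE eqxx andbT.
apply/forallP => -[x|]; apply/forallP => -[y|]; apply/implyP; rewrite !ffunE //=.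
- by move=> xy; have /forallP /(_ x) /forallP /(_ y) /implyP := gH; apply.
- by move=> _; rewrite adj_sym; have := svalP (g x); rewrite inE.
- by move=> _; have := svalP (g y); rewrite inE.
Qed.

End Cone.

Lemma card_Hom_empty (H G : sgraph) : #|H| = 0%N -> (0 < #|Hom H G|)%N.
Proof.
move=> H0; apply/card_gt0P; exists (ffun0 H0); rewrite inE.
by apply/forallP => x; have := fintype0 x H0.
Qed.

Theorem theorem3p2 (R : realType) (H : sgraph) :
  KNRS R H -> KNRS R (cone H).
Proof.
move=> knrs eta eta0; have [rho0 rho0_gt0 [n0 knrsP]] := knrs eta eta0.
(* The caps at 1 give [delta * rho <= 1], as the degree bounds require; [delta <= eta] lets the
   error absorb small neighbourhoods. *)
pose rho := Num.min rho0 1; pose delta := Num.min eta 1.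
have rho_gt0 : 0 < rho by rewrite lt_min rho0_gt0 ltr01.
have delta_gt0 : 0 < delta by rewrite lt_min eta0 ltr01.
have rho_le1 : rho <= 1 by rewrite ge_min lexx orbT.
have delta_le1 : delta <= 1 by rewrite ge_min lexx orbT.
have delta_eta : delta <= eta by rewrite ge_min lexx.
exists (delta * rho); first exact: mulr_gt0.
(* Chosen so that a neighbourhood of size at least [delta * #|G|] has at least [n0] vertices. *)
exists (Num.truncn (n0%:R / delta)).+1 => d G d0 dense nG.
have n_gt0 : (0 < #|G|)%N by apply: leq_ltn_trans nG.
have dr_le1 : delta * rho <= 1 by rewrite mulr_ile1 // ltW.
have d1 := locally_dense_le1 dr_le1 n_gt0 dense.
have n0_le : n0%:R <= delta * #|G|%:R.
  rewrite mulrC -ler_pdivrMr // ltW //.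
  by apply: lt_le_trans (truncnS_gt _) _; rewrite ler_nat.
set n := #|G|%:R : R; set h := #|H|; set e := #|edges H|.
have nR_gt0 : 0 < n by rewrite ltr0n.
have de1 : d ^+ e <= 1 by exact: exprn_ile1.
have de0 : 0 <= d ^+ e by exact: exprn_ge0.
(* The error is measured against [n ^+ h] rather than the degree, so that one bound covers large and
   small neighbourhoods. *)
have local (v : G) : d ^+ e * #|nbhd v|%:R ^+ h - eta * n ^+ h <=
    #|Hom H (induced (nbhd v))|%:R.
  have deg_le : #|nbhd v|%:R <= n by rewrite ler_nat max_card.
  have [big|small] := leP (delta * n) #|nbhd v|%:R.
    have deg_gt0 : 0 < #|nbhd v|%:R :> R by apply: lt_le_trans big; exact: mulr_gt0.
    have := knrsP d (induced (nbhd v)) d0.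
    rewrite /hom_density card_induced ler_pdivlMr ?exprn_gt0 // => knrsv.
    apply: le_trans (knrsv _ _); last first.
    - by rewrite -(ler_nat R) (le_trans n0_le).
    - apply: (@locally_dense_le _ _ rho); first by rewrite ge_min lexx.
      by apply: locally_dense_induced dense; rewrite // ltW.
    rewrite mulrBl lerB // ler_wpM2l ?(ltW eta0) //.
    by rewrite lerXn2r // ?nnegrE ?ler0n.
  (* For [h = 0] the power of the degree is 1 however small the degree is; the empty homomorphism
     compensates. *)
  case: (posnP h) => [h0|h_gt0].
    have := card_Hom_empty (induced (nbhd v)) h0.
    rewrite -(ler_nat R) h0 !expr0 !mulr1 => hom1.
    by rewrite (le_trans _ hom1) // lerBlDr (le_trans de1) // lerDl ltW.
  apply: le_trans (ler0n _ _); rewrite subr_le0.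
  apply: le_trans (ler_wpM2r _ de1) _; first by rewrite exprn_ge0.
  (* One factor of the degree is below [delta * n <= eta * n]; the other [h - 1] are at most [n]. *)
  rewrite mul1r -(prednK h_gt0) !exprS mulrA.
  apply: ler_pM => //; rewrite ?exprn_ge0 //.
    by apply: (le_trans (ltW small)); rewrite ler_wpM2r // ltW.
  by rewrite lerXn2r // ?nnegrE ?ler0n.
rewrite /hom_density card_option exprS -/n -/h.
rewrite ler_pdivlMr; last by rewrite mulr_gt0 ?exprn_gt0.
have homs : \sum_(v : G) #|Hom H (induced (nbhd v))|%:R <=
    #|Hom (cone H) G|%:R :> R by rewrite -natr_sum ler_nat card_Hom_cone.
apply: le_trans homs; apply: le_trans (ler_sum _ (fun v _ => local v)).
rewrite sumrB -mulr_sumr sumr_const -mulr_natl mulrBl.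
rewrite [eta * (n * _)]mulrCA lerB //.
have deg_sum := sum_deg_ge dr_le1 dense.
have := sum_expr_ge h (mulr_ge0 d0 (ltW nR_gt0)) (fun v => ler0n R #|nbhd v|) deg_sum.
move=> /(ler_wpM2l de0); apply: le_trans.
(* As [d <= 1], a lower bound on the number of edges of the cone suffices. *)
have coneE : d ^+ #|edges (cone H)| <= d ^+ e * d ^+ h.
  by rewrite -exprD ler_wiXn2l // card_edges_cone.
apply: le_trans (ler_wpM2r _ coneE) _; first by rewrite mulr_ge0 ?exprn_ge0 ?ltW.
by rewrite exprMn -!mulrA [n * (d ^+ h * _)]mulrCA.
Qed.
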